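(* Let $\alpha>0$ be irrational and let $z_{-1}\in\mathbb{C}$ be such that the greedy sequence $(z_n)$ with parameters $(\alpha,z_{-1})$ is defined for all $n\ge 0$, with sign sequence $(\varepsilon_n)_{n\ge0}$. If $(\varepsilon_n)_{n\ge 0}$ is $p$-periodic with $p$ odd, then the sign sequence of the greedy sequence with initial value $z_{-1}$ and parameter $\alpha+0.5 \pmod 1$ is $2p$-periodic.
   Context: Greedy sequence with parameters $(\alpha,z_{-1})$, where $\alpha>0$ is irrational and $z_{-1}\in\mathbb{C}$: for $n\ge 0$, $z_n=z_{n-1}+\varepsilon_n e^{2\pi i\alpha n}$ where the sign $\varepsilon_n\in\{-1,1\}$ is chosen so as to minimize $|z_n|$. If $|z_{n-1}+e^{2\pi i\alpha n}|=|z_{n-1}-e^{2\pi i\alpha n}|$ for some $n$, the sequence terminates at $z_{n-1}$ (neither $z_n$ nor $\varepsilon_n$, nor any later term, is defined). Here $x \bmod 1$ denotes the representative of $x$ in $[0,1)$. In this statement, a sequence $(s_n)_{n\ge 0}$ is called $p$-periodic if $p$ is its period, i.e. $p$ is the smallest positive integer such that $s_{n+p}=s_n$ for all $n\ge 0$. *)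

(* Defs.v *)
From Stdlib Require Import Reals ZArith Lra Lia.
From Coquelicot Require Import Coquelicot.
Open Scope R_scope.

Definition irrational (x : R) : Prop :=
  ~ exists a b : Z, b <> 0%Z /\ x = IZR a / IZR b.

Definition cexpi (t : R) : C := (cos t, sin t).

Definition rotation (alpha : R) (n : nat) : C := cexpi (2 * PI * alpha * INR n).

(* [prev zinit z n] is z_{n-1}, where [zinit] stands for z_{-1}. *)
Definition prev (zinit : C) (z : nat -> C) (n : nat) : C :=
  match n with O => zinit | S m => z m end.

(* [z] and [eps] are the terms z_0, z_1, ... and the signs of the greedy sequence
   with parameters (alpha, zinit), which moreover never terminates: the first
   conjunct excludes a tie at step n, upon which no later term is defined. *)
Definition is_greedy (alpha : R) (zinit : C) (z : nat -> C) (eps : nat -> R)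
  : Prop :=
  forall n : nat,
    let w := prev zinit z n in
    let u := rotation alpha n in
    Cmod (w + u)%C <> Cmod (w - u)%C /\
    (eps n = -1 \/ eps n = 1) /\
    z n = (w + RtoC (eps n) * u)%C /\
    (forall s : R, s = -1 \/ s = 1 -> Cmod (z n) <= Cmod (w + RtoC s * u)%C).

Definition is_periodic {A : Type} (s : nat -> A) (q : nat) : Prop :=
  forall n : nat, s (n + q)%nat = s n.

Definition is_least_period {A : Type} (s : nat -> A) (p : nat) : Prop :=
  (0 < p)%nat /\ is_periodic s p /\
  forall q : nat, (0 < q)%nat -> is_periodic s q -> (p <= q)%nat.

(* A non-terminating greedy sequence is determined by its parameters, so it is
   legitimate to speak of its sign sequence. *)
Lemma is_greedy_unique (alpha : R) (zinit : C) (z z' : nat -> C)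
  (eps eps' : nat -> R) :
  is_greedy alpha zinit z eps -> is_greedy alpha zinit z' eps' ->
  forall n : nat, z n = z' n /\ eps n = eps' n.
Proof.
intros H H'.
assert (step : forall n, prev zinit z n = prev zinit z' n ->
  z n = z' n /\ eps n = eps' n).
{ intros n Hw.
  destruct (H n) as (Hne & Hs & Hz & Hmin).
  destruct (H' n) as (_ & Hs' & Hz' & Hmin').
  rewrite <- Hw in Hz', Hmin'.
  assert (He : eps n = eps' n).
  { assert (L := Hmin _ Hs'). assert (L' := Hmin' _ Hs).
    rewrite Hz in L. rewrite Hz' in L'.
    assert (E := Rle_antisym _ _ L L'). clear L L' Hz Hz' Hmin Hmin'.
    set (w := prev zinit z n) in *. set (u := rotation alpha n) in *.
    assert (Ep : (w + RtoC 1 * u = w + u)%C) by ring.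
    assert (Em : (w + RtoC (-1) * u = w - u)%C).
    { apply injective_projections; simpl; ring. }
    destruct Hs as [Hs | Hs], Hs' as [Hs' | Hs']; rewrite Hs, Hs' in *;
      try reflexivity; rewrite Ep, Em in E; exfalso; apply Hne;
      [symmetry|]; exact E. }
  split; [|exact He]. now rewrite Hz, Hz', He. }
intros n; induction n as [|n IH]; apply step; simpl; [reflexivity | apply IH].
Qed.

(* Main.v *)
Require Import Defs.
From Stdlib Require Import Reals ZArith Arith Lra Lia.
From Coquelicot Require Import Coquelicot.
Open Scope R_scope.

(** Adding [1 / 2] to [alpha] (and reducing mod 1) multiplies the [n]-th step
    [rotation alpha n] by [(-1) ^ n].  At each step the greedy rule only sees
    the unordered pair [{u, -u}], so it produces the very same points [z n];
    the only change is that the sign becomes [(-1) ^ n * eps n]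
    ([rotation_half_shift], [is_greedy_sign_change]).

    What remains concerns periods only ([least_period_alternate]).  Being
    even, [2 * p] is a common period of [eps] and of the alternating sign.
    Conversely, let [q] be a period of [(-1) ^ n * eps n].  If [q] is even, it
    is a period of [eps], so [p] divides [q], and then [2 * p] divides [q]
    because [p] is odd.  If [q] is odd, [2 * q] is a period of [eps], so [p]
    divides [2 * q] and hence [q]; then [q] is a period of [eps] as well, while
    [eps (n + q) = - eps n], which is impossible for nonzero signs. *)

Section Periods.

Context {A : Type}.

Lemma is_periodic_mul (s : nat -> A) (p k : nat) :
  is_periodic s p -> is_periodic s (k * p).
Proof.
intros Hp; induction k as [|k IH]; intros n; simpl.
- now rewrite Nat.add_0_r.
- now rewrite Nat.add_assoc, IH, Hp.
Qed.

(** Euclidean division: the remainder of [q] by [p] is again a period, so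
    minimality of [p] makes it zero. *)
Lemma least_period_divide (s : nat -> A) (p q : nat) :
  is_least_period s p -> is_periodic s q -> Nat.divide p q.
Proof.
intros (Hp0 & Hp & Hmin) Hq.
assert (Hr : is_periodic s (q mod p)).
{ intros n.
  rewrite <- (is_periodic_mul s p (q / p) Hp (n + q mod p)%nat).
  replace (n + q mod p + q / p * p)%nat with (n + q)%nat; [apply Hq|].
  rewrite (Nat.div_mod_eq q p) at 1; lia. }
apply Nat.Lcm0.mod_divide.
destruct (Nat.eq_dec (q mod p) 0) as [E|E]; [exact E|].
assert (L := Hmin (q mod p)%nat ltac:(lia) Hr).
assert (B := Nat.mod_upper_bound q p ltac:(lia)). lia.
Qed.

End Periods.

Lemma odd_divide_double (p k : nat) :
  Nat.Odd p -> Nat.divide p (2 * k) -> Nat.divide p k.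
Proof.
intros [m Hm] [c Hc].
destruct (Nat.Even_or_Odd c) as [[d Hd]|[d Hd]].
- exists d; nia.
- exfalso; nia.
Qed.

Lemma pow_neg1_even (n : nat) : Nat.Even n -> (-1) ^ n = 1.
Proof. intros [m ->]; apply pow_1_even. Qed.

Lemma pow_neg1_odd (n : nat) : Nat.Odd n -> (-1) ^ n = -1.
Proof. intros [m ->]; rewrite Nat.add_1_r; apply pow_1_odd. Qed.

Lemma pow_neg1_cases (n : nat) : (-1) ^ n = -1 \/ (-1) ^ n = 1.
Proof.
destruct (Nat.Even_or_Odd n);
  [right; now apply pow_neg1_even | left; now apply pow_neg1_odd].
Qed.

Lemma is_periodic_alternate_even (s : nat -> R) (q : nat) :
  Nat.Even q ->
  is_periodic (fun n => (-1) ^ n * s n) q <-> is_periodic s q.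
Proof.
intros Hq; split; intros H n; specialize (H n); simpl in *.
- rewrite pow_add, (pow_neg1_even q Hq) in H.
  destruct (pow_neg1_cases n) as [E|E]; rewrite E in H; lra.
- now rewrite pow_add, (pow_neg1_even q Hq), H, Rmult_1_r.
Qed.

(** A nonzero value is what rules out an odd period of the alternated
    sequence: such a period would force [s q = s 0 = - s q]. *)
Lemma least_period_alternate (s : nat -> R) (p : nat) :
  s 0%nat <> 0 -> is_least_period s p -> Nat.Odd p ->
  is_least_period (fun n => (-1) ^ n * s n) (2 * p).
Proof.
intros Hs0 Hp Hodd.
assert (Hp' := Hp); destruct Hp' as (Hp0 & Hper & _).
repeat split; [lia| |].
- apply is_periodic_alternate_even; [now exists p|].
  now apply is_periodic_mul.
- intros q Hq0 Hq.
  destruct (Nat.Even_or_Odd q) as [Ev|Od].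
  + assert (Hd : Nat.divide p q).
    { apply (least_period_divide s p q Hp).
      now apply is_periodic_alternate_even. }
    destruct Ev as [k ->].
    apply odd_divide_double in Hd; [|exact Hodd].
    apply Nat.divide_pos_le in Hd; lia.
  + exfalso.
    assert (H2 : is_periodic s (2 * q)).
    { apply is_periodic_alternate_even; [now exists q|].
      now apply is_periodic_mul. }
    assert (Hd : Nat.divide p q).
    { apply odd_divide_double; [exact Hodd|].
      exact (least_period_divide s p _ Hp H2). }
    destruct Hd as [c Hc].
    assert (E : s q = s 0%nat).
    { rewrite Hc; exact (is_periodic_mul s p c Hper 0%nat). }
    specialize (Hq 0%nat); simpl in Hq.
    rewrite (pow_neg1_odd q Od), E in Hq; lra.
Qed.

Lemma cexpi_add_nat_period (x : R) (k : nat) :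
  cexpi (x + 2 * INR k * PI) = cexpi x.
Proof. unfold cexpi; now rewrite cos_period, sin_period. Qed.

Lemma cexpi_add_period (x : R) (k : Z) :
  cexpi (x + 2 * IZR k * PI) = cexpi x.
Proof.
destruct (Z_le_gt_dec 0 k) as [H|H].
- rewrite <- (Z2Nat.id k H), <- INR_IZR_INZ; apply cexpi_add_nat_period.
- rewrite <- (cexpi_add_nat_period _ (Z.to_nat (- k))).
  rewrite INR_IZR_INZ, Z2Nat.id, opp_IZR by lia.
  f_equal; ring.
Qed.

Lemma cexpi_add_half_turns (x : R) (n : nat) :
  cexpi (x + INR n * PI) = (RtoC ((-1) ^ n) * cexpi x)%C.
Proof.
induction n as [|n IH].
- simpl INR; simpl pow; rewrite Rmult_0_l, Rplus_0_r; ring.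
- rewrite S_INR.
  replace (x + (INR n + 1) * PI) with (x + INR n * PI + PI) by ring.
  transitivity (RtoC (-1) * cexpi (x + INR n * PI))%C.
  + unfold cexpi; rewrite neg_cos, neg_sin.
    apply injective_projections; simpl; ring.
  + rewrite IH; simpl pow; rewrite RtoC_mult; ring.
Qed.

Lemma rotation_half_shift (alpha : R) (n : nat) :
  rotation (frac_part (alpha + 1 / 2)) n
  = (RtoC ((-1) ^ n) * rotation alpha n)%C.
Proof.
unfold rotation, frac_part.
rewrite <- cexpi_add_half_turns.
rewrite <- (cexpi_add_period _ (Int_part (alpha + 1 / 2) * Z.of_nat n)).
f_equal; rewrite (INR_IZR_INZ n), mult_IZR; field.
Qed.

(** The pair of candidates [w + u], [w - u] is unchanged when [u] is replaced
    by [- u], so the same points stay greedy and the sign change of the step is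
    absorbed by the chosen sign. *)
Lemma is_greedy_sign_change (alpha beta : R) (zinit : C) (z : nat -> C)
  (eps sigma : nat -> R) :
  (forall n, sigma n = -1 \/ sigma n = 1) ->
  (forall n, rotation beta n = (RtoC (sigma n) * rotation alpha n)%C) ->
  is_greedy alpha zinit z eps ->
  is_greedy beta zinit z (fun n => sigma n * eps n).
Proof.
intros Hsigma Hrot H n; specialize (H n); cbv zeta in *.
rewrite Hrot; specialize (Hsigma n).
set (w := prev zinit z n) in *; set (u := rotation alpha n) in *.
destruct H as (Hne & Heps & Hz & Hmin).
assert (Hsq : sigma n * sigma n = 1) by (destruct Hsigma as [-> | ->]; ring).
repeat split.
- destruct Hsigma as [-> | ->].
  + replace (w + RtoC (-1) * u)%C with (w - u)%C
      by (apply injective_projections; simpl; ring).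
    replace (w - RtoC (-1) * u)%C with (w + u)%C
      by (apply injective_projections; simpl; ring).
    intros E; apply Hne; now symmetry.
  + now rewrite Cmult_1_l.
- destruct Hsigma as [-> | ->], Heps as [-> | ->]; lra.
- rewrite Hz, Cmult_assoc, <- RtoC_mult.
  replace (sigma n * eps n * sigma n) with (eps n); [reflexivity|].
  transitivity (eps n * (sigma n * sigma n)); [rewrite Hsq|]; ring.
- intros s Hs.
  rewrite Cmult_assoc, <- RtoC_mult; apply Hmin.
  destruct Hsigma as [-> | ->], Hs as [-> | ->]; lra.
Qed.

Theorem proposition4 :
  forall (alpha : R) (zinit : C) (z : nat -> C) (eps : nat -> R) (p : nat),
    0 < alpha -> irrational alpha ->
    is_greedy alpha zinit z eps ->
    is_least_period eps p -> Nat.Odd p ->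
    exists (z' : nat -> C) (eps' : nat -> R),
      is_greedy (frac_part (alpha + 1 / 2)) zinit z' eps' /\
      is_least_period eps' (2 * p)%nat.
Proof.
intros alpha zinit z eps p _ _ Hg Hp Hodd.
exists z, (fun n => (-1) ^ n * eps n); split.
- apply (is_greedy_sign_change alpha _ _ _ _ (pow (-1)) pow_neg1_cases);
    [apply rotation_half_shift | exact Hg].
- apply least_period_alternate; [|exact Hp|exact Hodd].
  destruct (Hg 0%nat) as (_ & [E|E] & _); rewrite E; lra.
Qed.
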